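(* Let $\sigma$ be a partition of the set $\mathbb{P}$ of all primes. The formation $\mathfrak{N}_\sigma$ of all $\sigma$-nilpotent groups is regular, and $\mathcal{I}_{\mathfrak{N}_\sigma}(G)=\mathrm{Z}_{\mathfrak{N}_\sigma}(G)$ holds for every finite group $G$. Moreover, the graph $\Gamma_{\mathfrak{N}_\sigma}(G)$ is connected and $\mathrm{diam}(\Gamma_{\mathfrak{N}_\sigma}(G))\leq 3$ for every finite group $G$.
   Context: All groups are finite. For a partition $\sigma=\{\pi_i\mid i\in I\}$ of $\mathbb{P}$, a group $G$ is $\sigma$-nilpotent if it has a normal Hall $\pi_i$-subgroup for every $i\in I$ with $\pi(G)\cap\pi_i\neq\emptyset$, where $\pi(G)$ is the set of prime divisors of $|G|$. A formation is a class of groups closed under epimorphic images and subdirect products. For a formation $\mathfrak{F}$ put $\mathcal{I}_{\mathfrak{F}}(G)=\{x\in G\mid \langle x,y\rangle\in\mathfrak{F}\ \text{for all } y\in G\}$. A subgroup $U$ of $G$ is $\mathfrak{F}$-maximal in $G$ if $U\in\mathfrak{F}$ and $U\le V\le G$, $V\in\mathfrak{F}$ imply $U=V$; $\mathrm{Int}_{\mathfrak{F}}(G)$ is the intersection of all $\mathfrak{F}$-maximal subgroups of $G$. The formation $\mathfrak{F}$ is called regular if $\mathcal{I}_{\mathfrak{F}}(G)=\mathrm{Int}_{\mathfrak{F}}(G)$ for every group $G$. A chief factor $H/K$ of $G$ is $\mathfrak{F}$-central in $G$ if $(H/K)\rtimes (G/C_G(H/K))\in\mathfrak{F}$ (action by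 conjugation). A normal subgroup $N$ of $G$ is $\mathfrak{F}$-hypercentral in $G$ if $N=1$, or $N\neq1$ and every chief factor of $G$ below $N$ is $\mathfrak{F}$-central in $G$. The $\mathfrak{F}$-hypercenter $\mathrm{Z}_{\mathfrak{F}}(G)$ is the product of all normal $\mathfrak{F}$-hypercentral subgroups of $G$. The non-$\mathfrak{F}$-graph $\Gamma_{\mathfrak{F}}(G)$ is the graph with vertex set $G\setminus\mathcal{I}_{\mathfrak{F}}(G)$ in which two vertices $x$ and $y$ are adjacent if $\langle x,y\rangle\notin\mathfrak{F}$. If the vertex set has fewer than two elements (in particular if it is empty), the assertions on connectedness and diameter are regarded as vacuously true. *)

(* Defs.v *)
From mathcomp Require Import all_boot all_fingroup all_solvable.
From mathcomp Require Import boolp.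

Set Implicit Arguments.
Unset Strict Implicit.
Unset Printing Implicit Defensive.

Local Open Scope group_scope.

Definition prime_partition (I : Type) (sigma : I -> nat_pred) : Prop :=
  [/\ forall i, exists p, p \in sigma i,
      forall i p, p \in sigma i -> prime p,
      forall p, prime p -> exists i, p \in sigma i
    & forall i j p, p \in sigma i -> p \in sigma j -> i = j].

Definition group_class := forall gT : finGroupType, {group gT} -> Prop.

Definition sigma_nilpotent (I : Type) (sigma : I -> nat_pred) : group_class :=
  fun gT G =>
    forall i, (exists2 p, p \in \pi(G) & p \in sigma i) ->
      exists2 H : {group gT}, H <| G & (sigma i).-Hall(G) H.

(* Subdirect products of two factors; those of any positive number of factors
   follow by iteration. Closure under isomorphism is a case of the first
   condition. *)
Definition formation (F : group_class) : Prop :=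
  (forall (aT rT : finGroupType) (G : {group aT}) (f : {morphism G >-> rT}),
     F aT G -> F rT (f @* G)%G) /\
  (forall (aT bT : finGroupType) (A : {group aT}) (B : {group bT})
          (G : {group aT * bT}),
     [set u.1 | u in G] = A -> [set u.2 | u in G] = B ->
     F aT A -> F bT B -> F (aT * bT)%type G).

Section Subgroups.

Variables (F : group_class) (gT : finGroupType).
Implicit Types G H K N U V : {group gT}.

Definition I_set G : {set gT} :=
  [set x in G | `[< forall y, y \in G -> F <<[set x; y]>>%G >]].

Definition F_maximal G U : Prop :=
  [/\ U \subset G, F U
    & forall V, U \subset V -> V \subset G -> F V -> U :=: V].

Definition Int_F G : {set gT} :=
  \bigcap_(U : {group gT} | `[< F_maximal G U >]) U.

End Subgroups.

Definition regular_formation (F : group_class) : Prop :=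
  formation F /\
  forall (gT : finGroupType) (G : {group gT}), I_set F G = Int_F F G.

Section ChiefFactors.

Variables (gT : finGroupType) (G H K : {group gT}).

(* In chief_factor the smaller subgroup comes first. *)
Hypothesis chiefHK : chief_factor G K H.

Local Notation C := 'C_G(H / K | 'Q).

Lemma chief_factor_acts : {acts G / C, on group H / K | 'Q %% C}.
Proof.
have [nsHG nKG] : H <| G /\ G \subset 'N(K).
  by case/andP: chiefHK => /maxgroupp/andP[_ nKG] nsHG.
have sGD : G \subset qact_dom 'J K by rewrite dom_qactJ.
have sCC : C \subset 'C(H / K | 'Q) := subsetIr _ _.
split; last first.
  by rewrite gacentC ?quotientS ?subsetT //= subIset // sGD.
rewrite astabs_mod // quotientS //; apply: actsQ => //; exact: normal_norm.
Qed.

(* The action of G / C_G(H / K) on H / K induced by conjugation in G. *)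
Definition chief_gact : groupAction (G / C) (H / K) :=
  <[chief_factor_acts]>%gact.

Lemma chief_gactE h a : h \in H -> a \in G ->
  chief_gact (coset K h) (coset C a) = coset K (h ^ a).
Proof.
move=> Hh Ga.
have [nHG nKG nKH] : [/\ G \subset 'N(H), G \subset 'N(K) & H \subset 'N(K)].
  case/andP: chiefHK => /maxgroupp/andP[_ nKG] /andP[sHG nHG].
  by split=> //; apply: subset_trans nKG.
have nKh := subsetP nKH h Hh; have nKa := subsetP nKG a Ga.
have sGC : G \subset 'N(C).
  rewrite normsI ?normG // (subset_trans _ (astab_norm _ _)) //.
  exact: actsQ.
have Da : a \in qact_dom 'J K by rewrite dom_qactJ.
have Fh : coset K h \in 'Fix_('Q)(qact_dom 'J K :&: C).
  apply/afixP=> c /setIP[_ /setIP[_ cHc]].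
  by rewrite (astab_act cHc) ?mem_quotient.
rewrite /= actbyE ?mem_quotient //= modactE ?(subsetP sGC) //.
by rewrite qactJ nKa morphJ.
Qed.

Definition F_central (F : group_class) : Prop :=
  F (sdprod_by chief_gact) [set: sdprod_by chief_gact]%G.

End ChiefFactors.

Section Hypercenter.

Variables (F : group_class) (gT : finGroupType).
Implicit Types G H K N : {group gT}.

Definition F_hypercentral G N : Prop :=
  N :=: 1 \/
  (N :!=: 1 /\
   forall H K (chiefHK : chief_factor G K H),
     H \subset N -> F_central chiefHK F).

(* A product of normal subgroups, so the enumeration order is irrelevant. *)
Definition Z_F G : {set gT} :=
  \prod_(N : {group gT} | (N <| G) && `[< F_hypercentral G N >]) gval N.

Definition nonF_vertices G : {set gT} := G :\: I_set F G.

Definition nonF_adj G : rel gT :=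
  [rel x y | [&& x \in nonF_vertices G, y \in nonF_vertices G, x != y
              & `[< ~ F <<[set x; y]>>%G >]]].

End Hypercenter.

(* Graphs given by a vertex set V of a finite type and an adjacency relation e
   both of whose arguments lie in V. *)
Section Graph.

Variables (T : finType) (V : {set T}) (e : rel T).

Definition graph_connected : Prop := {in V &, forall x y, connect e x y}.

Definition walk (n : nat) (x y : T) : bool :=
  [exists p : n.-tuple T, path e x p && (last x p == y)].

(* Least length of a walk from x to y; a shortest walk has length < #|T|, and
   the junk value #|T| is returned when y cannot be reached from x. *)
Definition graph_dist (x y : T) : nat :=
  find (fun n => walk n x y) (iota 0 #|T|).

(* Meaningful for connected graphs only. *)
Definition graph_diam : nat :=
  \max_(x in V) \max_(y in V) graph_dist x y.

End Graph.

(* Main.v *)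
Require Import Defs.
From mathcomp Require Import all_boot all_fingroup all_solvable.
From mathcomp Require Import boolp.

(** Everything rests on one property of an element x of G: for every class
sigma i, the sigma i-part of x commutes with all sigma i'-elements of G
([sigma_central]). Write F for the class of sigma-nilpotent groups.

In a sigma-nilpotent group, sigma i-elements commute with sigma i'-elements
([snil_cent]), and this characterises sigma-nilpotency ([snil_elts]); hence F
is closed under subgroups and subdirect products, while images carry Hall
subgroups along, and every x in I_F(G) is sigma-central. Conversely, let z be a sigma i-element of G commuting
with all sigma i'-elements. The sigma i'-elements of C, the centraliser in G
of all sigma i'-elements of G, are central in C, so by Schur-Zassenhaus C is
the direct product of its sigma i'-part and O_i(C). Thus z lies in the normal
sigma i-subgroup Z = O_i(C), which is centralised by the sigma i'-elements of
G ([central_pelt_normal]). Such a Z can be joined to any sigma-nilpotent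
subgroup U without losing sigma-nilpotency ([snil_joing]), so Z lies in every
F-maximal subgroup. Consequently I_F(G) = {sigma-central elements} = Int_F(G).

For the hypercenter, an F-central chief factor H/K is a sigma i-group for some
i and is centralised by the sigma i'-elements of G, and conversely
([F_central_commute], [commute_F_central]). By the description above, every
chief factor of G below I_F(G) is of this kind, so the normal subgroup I_F(G)
is hypercentral. That every hypercentral N lies in I_F(G) is an induction on
|N| along a chief factor N/K: the commutator of a sigma i-element of N with a
sigma i'-element of G lies in K, hence in I_F(G), and an order computation
kills it ([hypercentral_sub]).

For the graph, a vertex x has some part x_i failing to commute with a
sigma j-element a of G for some j <> i ([nonF_vertex_elt]); so x ~ a.
Likewise y ~ b for a vertex y. If none of x ~ b, y ~ a, a ~ b holds, then ab
is adjacent to both x and y ([nonF_walk]). *)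

Set Implicit Arguments.
Unset Strict Implicit.
Unset Printing Implicit Defensive.

Local Open Scope group_scope.

(** * Hall subgroups described by elements *)

Section HallElements.

Variable gT : finGroupType.
Implicit Types (G H K : {group gT}) (x y : gT) (pi : nat_pred).

(** An element is the product of its p-parts; in what follows this reduces
claims on sigma i'-elements, to which no single class need be attached, to
elements belonging to a class. *)
Lemma mem_constt_primes H x :
  (forall p : nat, p \in \pi(#[x]) -> x.`_p \in H) -> x \in H.
Proof.
move=> Hx; rewrite -(prod_constt x); apply: group_prod => p _.
have [/Hx // | pi'p] := boolP (p \in \pi(#[x])).
by rewrite (constt1P _) ?group1 // /p_elt p'natEpi.
Qed.

Lemma mem_constt_sub H x pi p : p \in pi -> x.`_pi \in H -> x.`_p \in H.
Proof.
move=> pi_p; rewrite -(@sub_in_constt _ p pi) => [Hx | q _ /eqP-> //].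
by rewrite groupX.
Qed.

Lemma index_mem_elts pi G H : H \subset G ->
  (forall x, x \in G -> pi.-elt x -> x \in H) -> pi^'.-nat #|G : H|.
Proof.
move=> sHG Hpi; apply/pnatP=> [|p p_pr dv_p]; first exact: indexg_gt0.
apply/negP=> pi_p; have [P sylP] := Sylow_exists p G.
have sPH : P \subset H.
  apply/subsetP=> x Px; apply: Hpi; first exact: subsetP (pHall_sub sylP) x Px.
  by apply: sub_p_elt (mem_p_elt (pHall_pgroup sylP) Px) => q /eqP->.
have: p %| #|G : P| by rewrite (dvdn_trans dv_p) // indexgS.
have: p^'.-nat #|G : P| by case/and3P: sylP.
by rewrite p'natE // => /negP.
Qed.

Lemma pcore_Hall_mem pi G :
  (forall x, x \in G -> pi.-elt x -> x \in 'O_pi(G)) -> pi.-Hall(G) 'O_pi(G).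
Proof.
move=> Opi; rewrite /pHall pcore_sub pcore_pgroup /=.
exact: index_mem_elts (pcore_sub _ _) Opi.
Qed.

(** The pi'-elements lie in the abelian group Z(G), so they form a central
normal Hall subgroup; a complement to it is then normal as well. *)
Lemma pcore_central_p'elts pi G :
  (forall y, y \in G -> pi^'.-elt y -> y \in 'Z(G)) -> pi.-Hall(G) 'O_pi(G).
Proof.
move=> Zpi'; set K := 'O_pi^'('Z(G)).
have sKZ : K \subset 'Z(G) := pcore_sub _ _.
have nsKG : K <| G by rewrite sub_center_normal.
have hallK : pi^'.-Hall(G) K.
  rewrite /pHall normal_sub // pcore_pgroup.
  apply: index_mem_elts (normal_sub nsKG) _ => y Gy pi'y.
  have hallKZ := nilpotent_pcore_Hall pi^' (abelian_nil (center_abelian G)).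
  by rewrite (mem_Hall_pcore hallKZ) ?Zpi'.
have /splitsP[L /complP[tiKL defG]] := SchurZassenhaus_split (pHall_Hall hallK) nsKG.
have [_ sLG] := mulG_sub defG.
have nLG : G \subset 'N(L).
  rewrite -defG mul_subG ?normG // cents_norm //.
  by apply: subset_trans (subset_trans sKZ (subsetIr _ _)) (centS sLG).
have nsLG : L <| G by apply/andP.
have hallL : pi.-Hall(G) L.
  by rewrite -pHallNK -(compl_pHall L hallK); apply/complP.
by rewrite (normal_Hall_pcore hallL).
Qed.

(** Z is O_pi(C), where C is the centraliser in G of all pi'-elements of G:
the pi'-elements of C are central in C, so O_pi(C) is a Hall subgroup of C and
absorbs every pi-element of C. *)
Lemma central_pelt_normal pi G x : x \in G -> pi.-elt x ->
    (forall y, y \in G -> pi^'.-elt y -> y \in 'C[x]) ->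
  exists2 Z : {group gT}, x \in Z &
    [/\ Z <| G, pi.-group Z
      & forall y, y \in G -> pi^'.-elt y -> y \in 'C(Z)].
Proof.
move=> Gx pix cx; pose A := [set y in G | pi^'.-elt y].
have nAG : G \subset 'N(A).
  apply/subsetP=> z Gz; rewrite inE; apply/subsetP=> _ /imsetP[y + ->].
  by rewrite !inE => /andP[Gy i'y]; rewrite groupJ // p_eltJ.
have nsCG : 'C_G(A) <| G by rewrite -{2}(setIidPl nAG) subcent_normal.
have AP y : y \in G -> pi^'.-elt y -> y \in A by rewrite inE => -> ->.
have hallC : pi.-Hall('C_G(A)) 'O_pi('C_G(A)).
  apply: pcore_central_p'elts => y CAy pi'y; rewrite inE CAy /=.
  apply/centP=> z /setIP[_ /centP/(_ y)]; have [Gy _] := setIP CAy.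
  by move=> cz; apply/esym/cz/AP.
exists 'O_pi('C_G(A))%G; first rewrite (mem_Hall_pcore hallC) // inE Gx /=.
  by apply/centP=> y; rewrite inE => /andP[Gy pi'y]; apply/esym/cent1P/cx.
split; rewrite ?pcore_pgroup ?(char_normal_trans (pcore_char _ _)) // => y Gy pi'y.
apply/centP=> z /(subsetP (pcore_sub _ _))/setIP[_ /centP cz].
by apply/esym/cz/AP.
Qed.

End HallElements.

(** * The formation of sigma-nilpotent groups *)

Section SigmaNilpotent.

Variables (I : Type) (sigma : I -> nat_pred).
Hypothesis sigmaP : prime_partition sigma.
Local Notation snil := (sigma_nilpotent sigma).

Lemma class_of_prime p : prime p -> exists i, p \in sigma i.
Proof. by case: sigmaP => _ _ + _; apply. Qed.

Lemma class_inj i j p : p \in sigma i -> p \in sigma j -> i = j.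
Proof. by case: sigmaP => _ _ _; apply. Qed.

Section OneGroup.

Variable gT : finGroupType.
Implicit Types (G H K N U V : {group gT}) (x y : gT).

Lemma class_subC i j : i <> j -> {subset sigma j <= (sigma i)^'}.
Proof. by move=> ij p jp; apply/negP=> ip; case: ij; apply: class_inj jp. Qed.

Lemma mem_sigma_constt H x : (forall i, x.`_(sigma i) \in H) -> x \in H.
Proof.
move=> Hx; apply: mem_constt_primes => p; rewrite mem_primes => /andP[p_pr _].
by have [i ip] := class_of_prime p_pr; apply: mem_constt_sub ip (Hx i).
Qed.

(** This form also covers the classes prime to the order of G, so that no
case distinction on i is needed later. *)
Lemma snilP G : snil G <-> forall i, (sigma i).-Hall(G) 'O_(sigma i)(G).
Proof.
split=> [nilG i | hallG i _]; last by exists 'O_(sigma i)(G)%G; rewrite ?pcore_normal.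
have [i'G | ] := boolP ((sigma i)^'.-group G); last first.
  rewrite /pgroup /pnat cardG_gt0 => /allPn[p piGp]; rewrite negbK => ip.
  have [|H nsHG hallH] := nilG i; first by exists p.
  by rewrite (normal_Hall_pcore hallH nsHG).
by rewrite /pHall pcore_sub pcore_pgroup (pnat_dvd (dvdn_indexg _ _)).
Qed.

(** By [central_pelt_normal], O_i(G) contains every sigma i-element of G, so it
is a Hall subgroup. The condition on elements can be checked coordinatewise
and is inherited by subgroups, which is how closure properties are proved. *)
Lemma snil_elts G :
  (forall i x y, x \in G -> y \in G ->
     (sigma i).-elt x -> (sigma i)^'.-elt y -> y \in 'C[x]) -> snil G.
Proof.
move=> cG; apply/snilP=> i; apply: pcore_Hall_mem => x Gx ix.
have [|Z Zx [nsZG iZ _]] := @central_pelt_normal _ (sigma i) G x Gx ix.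
  by move=> y Gy; apply: cG.
by apply: subsetP Zx; apply: pcore_max.
Qed.

(** A p-part of y, with p in another class sigma j, lies in O_j(H), which
intersects O_i(H) trivially; two normal subgroups meeting trivially
commute. *)
Lemma snil_cent H i x y : snil H -> x \in H -> y \in H ->
  (sigma i).-elt x -> (sigma i)^'.-elt y -> y \in 'C[x].
Proof.
move=> /snilP hallH Hx Hy ix i'y; apply: mem_constt_primes => p piyp.
have p_pr : prime p by move: piyp; rewrite mem_primes => /andP[].
have [j jp] := class_of_prime p_pr.
have Oix : x \in 'O_(sigma i)(H) by rewrite (mem_Hall_pcore (hallH i)).
have Ojy : y.`_p \in 'O_(sigma j)(H).
  rewrite (mem_Hall_pcore (hallH j)) ?groupX //.
  by apply: sub_p_elt (p_elt_constt _ _) => q /eqP->.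
have TI : 'O_(sigma i)(H) :&: 'O_(sigma j)(H) = 1.
  apply/coprime_TIg/(pnat_coprime (pcore_pgroup _ _)).
  apply: sub_pgroup (pcore_pgroup _ _) => q jq; apply/negP=> iq.
  by have /negP[] := pnatPpi i'y piyp; rewrite (class_inj iq jq).
have /centsP cO : 'O_(sigma i)(H) \subset 'C('O_(sigma j)(H)).
  rewrite (sameP commG1P trivgP) -TI commg_subI //.
    by rewrite subsetI subxx (subset_trans (pcore_sub _ _)) ?gFnorm.
  by rewrite subsetI subxx (subset_trans (pcore_sub _ _)) ?gFnorm.
by apply/cent1P/esym; apply: cO.
Qed.

Lemma snil_elt_mul H i x y : snil H -> x \in H -> y \in H ->
  (sigma i).-elt x -> (sigma i).-elt y -> (sigma i).-elt (x * y).
Proof.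
move=> /snilP hallH Hx Hy ix iy.
apply: (mem_p_elt (pcore_pgroup (sigma i) H)).
by rewrite groupM // (mem_Hall_pcore (hallH i)).
Qed.

Lemma snil_sub H G : H \subset G -> snil G -> snil H.
Proof.
move=> /subsetP sHG nilG; apply: snil_elts => i x y Hx Hy.
exact: snil_cent nilG (sHG x Hx) (sHG y Hy).
Qed.

Lemma snil_sigma_group i G : (sigma i).-group G -> snil G.
Proof.
move=> iG j [p piGp jp]; have <-: i = j by apply: class_inj (pnatPpi iG piGp) jp.
by exists G; rewrite // /pHall subxx iG indexgg.
Qed.

Lemma snil_cycle x : snil <[x]>%G.
Proof.
by apply/snilP=> i; rewrite nilpotent_pcore_Hall // abelian_nil ?cycle_abelian.
Qed.

End OneGroup.

Lemma snil_morphim (aT rT : finGroupType) (D G : {group aT})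
    (f : {morphism D >-> rT}) :
  G \subset D -> snil G -> snil (f @* G)%G.
Proof.
move=> sGD /snilP hallG i _; exists (f @* 'O_(sigma i)(G))%G.
  exact/morphim_normal/pcore_normal.
exact: morphim_pHall (subset_trans (pcore_sub _ _) sGD) (hallG i).
Qed.

Lemma snil_formation : formation snil.
Proof.
split=> [aT rT G f | aT bT A B G defA defB nilA nilB]; first exact: snil_morphim (subxx G).
have pi_fst pi (u : aT * bT) : pi.-elt u -> pi.-elt u.1.
  exact: (@morph_p_elt _ _ _ (fst_morphism aT bT)) (in_setT u).
have pi_snd pi (u : aT * bT) : pi.-elt u -> pi.-elt u.2.
  exact: (@morph_p_elt _ _ _ (snd_morphism aT bT)) (in_setT u).
apply: snil_elts => i u v Gu Gv iu i'v.
have /cent1P cA : v.1 \in 'C[u.1].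
  by apply: (snil_cent (H := A) (i := i)); rewrite -?defA ?imset_f ?pi_fst.
have /cent1P cB : v.2 \in 'C[u.2].
  by apply: (snil_cent (H := B) (i := i)); rewrite -?defB ?imset_f ?pi_snd.
by apply/cent1P; congr (_, _).
Qed.

(** * Sigma-central elements and regularity *)

Section Regularity.

Variable gT : finGroupType.
Implicit Types (G H K N U V Z : {group gT}) (x y : gT).

(** Modulo Z, ZU is an image of U, which gives the Hall subgroup for sigma i.
For j <> i, O_j(U) is centralised by Z, hence still normal in ZU, and its index
in ZU divides |Z| |U : O_j(U)|. *)
Lemma snil_joing i G Z U :
    Z <| G -> (sigma i).-group Z ->
    (forall y, y \in G -> (sigma i)^'.-elt y -> y \in 'C(Z)) ->
  U \subset G -> snil U -> snil (Z <*> U)%G.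
Proof.
move=> /andP[sZG nZG] iZ cZ sUG nilU; have nZU := subset_trans sUG nZG.
have nsZV : Z <| Z <*> U by rewrite normalYl.
apply/snilP=> j; have [<- | ij] := EM (i = j).
  have nsZO := normalS (pcore_max iZ nsZV) (pcore_sub _ _) nsZV.
  rewrite -(pquotient_pHall iZ nsZV nsZO) -pquotient_pcore // quotientYidl //.
  by move/snilP: (snil_morphim (f := coset Z) nZU nilU).
set W := 'O_(sigma j)(U).
have hallW : (sigma j).-Hall(U) W := proj1 (snilP U) nilU j.
have cZW : W \subset 'C(Z).
  apply/subsetP=> y Wy; apply: cZ.
    exact: (subsetP sUG) (subsetP (pcore_sub _ _) y Wy).
  exact: sub_p_elt (class_subC ij) (mem_p_elt (pcore_pgroup _ _) Wy).
have nsWV : W <| Z <*> U.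
  rewrite /normal (subset_trans (pcore_sub _ _)) ?joing_subr // join_subG.
  by rewrite gFnorm cents_norm // centsC.
have sWV := normal_sub nsWV.
suff hallWV : (sigma j).-Hall(Z <*> U) W by rewrite (normal_Hall_pcore hallWV).
rewrite /pHall sWV pcore_pgroup /=.
have j'ZU : (sigma j)^'.-nat (#|Z| * #|U : W|)%N.
  rewrite pnatM; case/and3P: hallW => _ _ ->; rewrite andbT.
  by apply: sub_pgroup iZ; apply/class_subC/nesym.
apply: pnat_dvd j'ZU; rewrite -(dvdn_pmul2r (cardG_gt0 W)) -mulnA.
rewrite ![(#|_ : _| * _)%N]mulnC !Lagrange ?pcore_sub // mul_cardG.
by rewrite /= norm_joinEr // dvdn_mulr.
Qed.

Definition sigma_central G x : Prop :=
  forall i y, y \in G -> (sigma i)^'.-elt y -> y \in 'C[x.`_(sigma i)].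

(** By maximality, U absorbs the normal sigma i-subgroup that
[central_pelt_normal] attaches to each part of x. *)
Lemma sigma_central_max G U x :
  F_maximal snil G U -> x \in G -> sigma_central G x -> x \in U.
Proof.
case=> sUG nilU maxU Gx cx; apply: mem_sigma_constt => i.
have [Z Zxi [nsZG iZ cZ]] :=
  central_pelt_normal (groupX _ Gx) (p_elt_constt _ _) (cx i).
have -> : U :=: Z <*> U.
  apply: (maxU (Z <*> U)%G); rewrite ?joing_subr ?join_subG ?(normal_sub nsZG) //.
  exact: (snil_joing nsZG iZ cZ).
by rewrite (subsetP (joing_subl _ _)).
Qed.

Lemma snil_max_exists G U : U \subset G -> snil U ->
  exists2 M : {group gT}, F_maximal snil G M & U \subset M.
Proof.
move=> sUG nilU; pose P := [pred V : {group gT} | (V \subset G) && `[< snil V >]].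
have PU : P U by rewrite /= sUG; apply/asboolP.
have [M /maxgroupP[/andP[sMG /asboolP nilM] maxM] sUM] := maxgroup_exists PU.
exists M => //; split=> // V sMV sVG nilV; apply/esym/maxM => //=.
by rewrite sVG; apply/asboolP.
Qed.

Lemma Int_FP G x :
  reflect (forall U, F_maximal snil G U -> x \in U) (x \in Int_F snil G).
Proof.
apply: (iffP bigcapP) => Int_x U; first by move/asboolP; apply: Int_x.
by move/asboolP; apply: Int_x.
Qed.

Lemma I_setP G x :
  reflect (x \in G /\ forall y, y \in G -> snil <<[set x; y]>>%G)
          (x \in I_set snil G).
Proof.
rewrite inE; apply: (iffP andP) => -[Gx nilx]; split=> //; first exact/asboolP.
exact/asboolP.
Qed.

Lemma gen2l x y : x \in <<[set x; y]>>.
Proof. by rewrite mem_gen // set21. Qed.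

Lemma gen2r x y : y \in <<[set x; y]>>.
Proof. by rewrite mem_gen // set22. Qed.

Lemma gen2_sub G x y : x \in G -> y \in G -> <<[set x; y]>> \subset G.
Proof. by move=> Gx Gy; rewrite gen_subG subUset !sub1set Gx. Qed.

(** An F-maximal subgroup containing y also contains the sigma-central element
x, hence <x, y>. *)
Lemma I_set_central G x :
  x \in I_set snil G <-> x \in G /\ sigma_central G x.
Proof.
split=> [/I_setP[Gx nilx] | [Gx cx]].
  split=> // i y Gy i'y; apply: snil_cent (nilx y Gy) _ _ (p_elt_constt _ _) i'y.
    by rewrite groupX ?gen2l.
  exact: gen2r.
apply/I_setP; split=> // y Gy.
have [|M maxM sxM] := @snil_max_exists G <[y]>%G _ (snil_cycle (x := y)).
  by rewrite cycle_subG.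
have [sMG nilM _] := maxM; apply: snil_sub nilM; rewrite gen2_sub //.
  exact: sigma_central_max maxM Gx cx.
by rewrite -cycle_subG.
Qed.

Lemma I_set_Int G : I_set snil G = Int_F snil G.
Proof.
apply/setP=> x; apply/idP/Int_FP => [/I_set_central[Gx cx] U maxU | Ux].
  exact: sigma_central_max maxU Gx cx.
have memM U : U \subset G -> snil U ->
      exists2 M : {group gT}, [/\ M \subset G, snil M & U \subset M] & x \in M.
  move=> sUG nilU; have [M maxM sUM] := snil_max_exists sUG nilU.
  by exists M; [case: maxM | apply: Ux].
have Gx : x \in G.
  have [|M [/subsetP sMG _ _] /sMG //] := memM <[1]>%G _ (snil_cycle (x := 1)).
  by rewrite cycle_subG.
apply/I_setP; split=> // y Gy.
have [|M [_ nilM sxM] Mx] := memM <[y]>%G _ (snil_cycle (x := y)).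
  by rewrite cycle_subG.
by apply: snil_sub nilM; rewrite gen2_sub // -cycle_subG.
Qed.

End Regularity.


(** * The hypercenter *)

Section Hypercenter.

Variable gT : finGroupType.
Implicit Types (G H K N U V Z : {group gT}) (x y : gT).

(** O_i(H/K) is characteristic in the minimal normal subgroup H/K, and for the
class i of a prime dividing |H/K| it is not trivial. *)
Lemma chief_factor_sigma_group G H K :
  chief_factor G K H -> snil (H / K)%G -> exists i, (sigma i).-group (H / K).
Proof.
move=> chiefHK /snilP hallHK.
have /mingroupP[/andP[ntHK nHKG] minHK] := chief_factor_minnormal chiefHK.
have: pdiv #|H / K| \in \pi(H / K) by rewrite pi_pdiv cardG_gt1.
set p := pdiv _ => pHK.
have [i ip] : exists i, p \in sigma i.
  by apply: class_of_prime; move: pHK; rewrite mem_primes => /andP[].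
exists i; rewrite -(minHK 'O_(sigma i)(H / K)%G) ?pcore_pgroup ?pcore_sub //=.
rewrite (char_norm_trans (pcore_char _ _) nHKG) andbT.
apply/eqP=> O1; have := hallHK i; rewrite /= O1 => /and3P[_ _].
by rewrite indexg1 => /pnatPpi/(_ pHK)/negP.
Qed.

Lemma chief_factor_norms G H K : chief_factor G K H ->
  [/\ H \subset G, G \subset 'N(H), G \subset 'N(K)
    & G \subset 'N('C_G(H / K | 'Q))].
Proof.
case/andP=> /maxgroupp/andP[_ nKG] /andP[sHG nHG]; split=> //.
rewrite normsI ?normG // (subset_trans _ (astab_norm _ _)) //.
exact: actsQ.
Qed.

(** In the semidirect product, the image of a sigma i'-element y of G commutes
with the sigma i-group H/K; so y fixes each coset of K in H. *)
Lemma F_central_commute G H K (chiefHK : chief_factor G K H) :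
  F_central chiefHK snil ->
  exists2 i, (sigma i).-group (H / K) &
    forall h y, h \in H -> y \in G -> (sigma i)^'.-elt y -> [~ h, y] \in K.
Proof.
rewrite /F_central; set to := chief_gact chiefHK => nilS.
have [sHG nHG nKG nCG] := chief_factor_norms chiefHK.
have nilHK : snil (H / K)%G.
  have nil1 : snil (sdpair1 to @* (H / K))%G by apply: snil_sub nilS; apply: subsetT.
  have := snil_morphim (f := invm (injm_sdpair1 to)) (subxx _) nil1.
  suff -> : (invm (injm_sdpair1 to) @* (sdpair1 to @* (H / K)))%G = (H / K)%G by [].
  by apply/val_inj/(@im_invm _ _ _ _ (injm_sdpair1 to)).
have [i iHK] := chief_factor_sigma_group chiefHK nilHK.
exists i => // h y Hh Gy i'y.
have nKh : h \in 'N(K) by rewrite (subsetP nKG) // (subsetP sHG).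
have nKy : y \in 'N(K) by rewrite (subsetP nKG).
set C := 'C_G(H / K | 'Q).
have Cy : coset C y \in G / C by rewrite mem_quotient.
have hK : coset K h \in H / K by rewrite mem_quotient.
have /cent1P cyh : sdpair2 to (coset C y) \in 'C[sdpair1 to (coset K h)].
  apply: (snil_cent (i := i)) nilS (in_setT _) (in_setT _) _ _.
    exact/morph_p_elt/(mem_p_elt iHK).
  apply: morph_p_elt => //; apply: morph_p_elt => //.
  exact: subsetP nCG y Gy.
have := sdpair_act to hK Cy; rewrite conjgE -cyh mulKg chief_gactE //.
move/(injmP (injm_sdpair1 to)); rewrite mem_quotient ?memJ_norm ?(subsetP nHG) // => /(_ isT hK) eq_hy.
apply: coset_idr; first by rewrite groupR.
by rewrite commgEl morphM ?groupV ?groupJ //= eq_hy -morphM ?groupV // mulVg morph1.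
Qed.

(** The centraliser of H/K contains all sigma i'-elements of G, so the whole
semidirect product is a sigma i-group. *)
Lemma commute_F_central i G H K (chiefHK : chief_factor G K H) :
    (sigma i).-group (H / K) ->
    (forall h y, h \in H -> y \in G -> (sigma i)^'.-elt y -> [~ h, y] \in K) ->
  F_central chiefHK snil.
Proof.
move=> iHK cHK; rewrite /F_central; set to := chief_gact chiefHK.
have [sHG _ nKG nCG] := chief_factor_norms chiefHK.
have nKH := subset_trans sHG nKG.
have iGC : (sigma i).-group (G / 'C_G(H / K | 'Q)).
  rewrite /pgroup card_quotient // -pnatNK.
  apply: index_mem_elts; first exact: subsetIl.
  move=> y Gy i'y; rewrite inE Gy /= -sub1set sub_astabQR ?sub1set ?(subsetP nKG) //.
  rewrite gen_subG; apply/subsetP=> _ /imset2P[_ h /set1P-> Hh ->].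
  by rewrite -invg_comm groupV cHK.
apply: (@snil_sigma_group _ i); rewrite /pgroup -(sdprod_card (sdprod_sdpair to)).
by rewrite pnatM; apply/andP; split; apply: morphim_pgroup.
Qed.

Lemma I_set_group_set G : group_set (I_set snil G).
Proof.
rewrite I_set_Int; apply/group_setP; split=> [|x y /Int_FP Ux /Int_FP Uy].
  by apply/Int_FP=> U _.
by apply/Int_FP=> U maxU; rewrite groupM ?Ux ?Uy.
Qed.

Definition I_group G := Group (I_set_group_set G).

Lemma I_group_normal G : I_group G <| G.
Proof.
apply/andP; split; first by apply/subsetP=> x /I_set_central[].
apply/subsetP=> g Gg; rewrite inE; apply/subsetP=> _ /imsetP[x Ix ->].
have [Gx cx] := proj1 (I_set_central _ _) Ix.
apply/I_set_central; split=> [|i y Gy i'y]; first by rewrite groupJ.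
by rewrite consttJ cent1J mem_conjg cx ?groupJ ?groupV ?p_eltJ.
Qed.

Lemma I_set_elt i G x : x \in G -> (sigma i).-elt x ->
    (forall y, y \in G -> (sigma i)^'.-elt y -> y \in 'C[x]) ->
  x \in I_set snil G.
Proof.
move=> Gx ix cx; apply/I_set_central; split=> // j y Gy j'y.
have [ij | ij] := EM (i = j).
  by rewrite -ij constt_p_elt // cx // ij.
rewrite (constt1P _) ?cent11T ?inE //.
exact: sub_p_elt (class_subC (nesym ij)) ix.
Qed.

(** Let N/K be a chief factor, a sigma i-group. A part of an element of N
for a class other than i lies in K, which is covered by induction. For a
sigma i-element z of N and a sigma i'-element y of G, k = [z, y] lies in K,
hence in I_F(G). Its sigma i'-part is the sigma i'-part of the sigma i-element
z^y = z k, so it is trivial; then k^-1 is the sigma i-part of the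
sigma i'-element y^z = y k^-1, so k = 1. *)
Lemma hypercentral_sub G N :
  N <| G -> F_hypercentral snil G N -> N \subset I_set snil G.
Proof.
have [n] := ubnP #|N|; elim: n => // n IHn in N * => leNn nsNG.
rewrite -[I_set _ _]/(gval (I_group G)).
case=> [-> | [ntN centN]]; first exact: sub1G.
have [K maxK _] : {K : {group gT} | maxnormal K N G & [1 gT] \subset K}.
  by apply: maxgroup_exists; rewrite proper1G ntN norms1.
have chiefNK : chief_factor G K N by rewrite /chief_factor maxK.
have /andP[/andP[sKN _] nKG] := maxgroupp maxK.
have ltKN : K \proper N by case/andP: (maxgroupp maxK).
have [sNG nNG] := andP nsNG.
have sKI : K \subset I_set snil G.
  apply: IHn; first exact: leq_trans (proper_card ltKN) leNn.
    by rewrite /normal (subset_trans sKN).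
  have [/eqP K1 | ntK] := boolP (K :==: 1); [by left | right; split=> // H L chiefHL sHK].
  exact: centN (subset_trans sHK sKN).
have [i iNK cNK] := F_central_commute (centN N K chiefNK (subxx _)).
have nKN := subset_trans sNG nKG.
apply/subsetP=> x Nx; apply: mem_sigma_constt => j.
have Nz : x.`_(sigma j) \in N by rewrite groupX.
have jz := p_elt_constt (sigma j) x; move: {x Nx}(x.`_(sigma j)) Nz jz => z Nz jz.
have Gz := subsetP sNG z Nz; have nKz := subsetP nKN z Nz.
have [ij | ij] := EM (i = j); last first.
  apply: (subsetP sKI); apply: coset_idr => //; apply/eqP; rewrite -order_eq1.
  apply/eqP/(@pnat_1 (sigma i)); first exact: mem_p_elt iNK (mem_quotient _ Nz).
  exact/morph_p_elt/(sub_p_elt (class_subC ij)).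
rewrite -{j}ij in jz *; apply: (I_set_elt Gz jz) => y Gy i'y.
have [Gk nilk] := I_setP _ _ (subsetP sKI _ (cNK z y Nz Gy i'y)).
set k := [~ z, y] in Gk nilk.
have nilkz := nilk z Gz; have nilky := nilk y Gy.
(* k generates a sigma-nilpotent group with z: its parts sort out z ^ y. *)
have ik : (sigma i).-elt k.
  rewrite -p_eltNK; apply/constt1P; have: (z ^ y).`_(sigma i)^' = 1.
    by apply/constt1P; rewrite p_eltNK p_eltJ.
  rewrite conjg_mulR -/k -{1}(consttC (sigma i) k) mulgA consttM.
    rewrite (constt1P _ : (z * _).`__ = 1) ?mul1g.
      by rewrite constt_p_elt ?p_elt_constt.
    by rewrite p_eltNK (snil_elt_mul nilkz) ?p_elt_constt ?groupX ?gen2l ?gen2r.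
  apply/esym/cent1P; rewrite (snil_cent nilkz (i := i)) ?p_elt_constt //;
    rewrite ?groupM ?groupX ?gen2l ?gen2r //.
  by rewrite (snil_elt_mul nilkz) ?p_elt_constt ?groupX ?gen2l ?gen2r.
apply/cent1P/esym/commgP; rewrite -/k.
(* The same with y, using [~ y, z] = k^-1. *)
have: (y ^ z).`_(sigma i) = 1 by apply/constt1P; rewrite p_eltJ.
rewrite conjg_mulR -invg_comm -/k consttM; last first.
  apply/commuteV/cent1P.
  by rewrite (snil_cent nilky (i := i)) ?gen2l ?gen2r.
rewrite (constt1P _ : y.`__ = 1) ?mul1g // constt_p_elt ?p_eltV //.
by move/eqP; rewrite invg_eq1.
Qed.

Lemma mem_prod_groups (s : seq {group gT}) (P : pred {group gT}) N x :
  N \in s -> P N -> x \in N -> x \in \prod_(M <- s | P M) gval M.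
Proof.
move=> sN PN Nx.
have mem1 (r : seq {group gT}) : 1 \in \prod_(M <- r | P M) gval M.
  by elim/big_ind: _ => [|A B A1 B1|M _]; rewrite ?set11 ?group1 // -[1]mulg1 mem_mulg.
elim: s sN => //= M s IHs; rewrite inE big_cons => /predU1P[<- | /IHs sx].
  by rewrite PN -[x]mulg1 mem_mulg.
by case: ifP => // _; rewrite -[x]mul1g mem_mulg ?group1.
Qed.

(** Let H/K be a chief factor below I_F(G). As H lies in an F-maximal subgroup,
H/K is a sigma i-group for some i, so the coset of h in H is also the coset
of the sigma i-part of h, which commutes with all sigma i'-elements. *)
Lemma I_set_Z G : I_set snil G = Z_F snil G.
Proof.
apply/eqP; rewrite eqEsubset; apply/andP; split; last first.
  rewrite /Z_F -[I_set _ _]/(gval (I_group G)).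
  elim/big_ind: _ => [|A B sA sB|N /andP[nsNG /asboolP]]; first exact: sub1G.
    exact: mul_subG.
  exact: hypercentral_sub.
apply/subsetP=> x Ix; apply: (@mem_prod_groups _ _ (I_group G)) => //.
  exact: mem_index_enum.
rewrite I_group_normal; apply/asboolP.
have [/eqP I1 | ntI] := boolP (I_group G :==: 1); [by left | right; split=> //].
move=> H K chiefHK sHI; have [sHG _ nKG _] := chief_factor_norms chiefHK.
have nKH := subset_trans sHG nKG.
have nilH : snil H.
  have [|M maxM _] := @snil_max_exists _ G <[1]>%G _ (snil_cycle (x := 1)).
    by rewrite cycle_subG.
  have [_ nilM _] := maxM; apply: snil_sub nilM.
  apply/subsetP=> h /(subsetP sHI); rewrite /= I_set_Int => /Int_FP; exact.
have [i iHK] := chief_factor_sigma_group chiefHK (snil_morphim (f := coset K) nKH nilH).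
apply: (commute_F_central iHK) => h y Hh Gy i'y.
have [_ ch] := proj1 (I_set_central _ _) (subsetP sHI h Hh).
have nKh := subsetP nKH h Hh; have nKy := subsetP nKG y Gy.
apply: coset_idr; first by rewrite groupR.
rewrite morphR //= -(constt_p_elt (mem_p_elt iHK (mem_quotient K Hh))) -morph_constt //=.
by rewrite -morphR ?groupX // (eqP (introT commgP (esym (cent1P (ch i y Gy i'y))))) morph1.
Qed.

End Hypercenter.

(** * The non-sigma-nilpotent graph *)

Section NonNilpotentGraph.

Variable gT : finGroupType.
Implicit Types (G H : {group gT}) (x y : gT).

Lemma gen2C x y : <<[set x; y]>>%G = <<[set y; x]>>%G.
Proof. by apply/val_inj; rewrite /= setUC. Qed.

Lemma nonF_adjI G x y :
  x \in G -> y \in G -> ~ snil <<[set x; y]>>%G -> nonF_adj snil G x y.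
Proof.
have vertexI u v : u \in G -> v \in G -> ~ snil <<[set u; v]>>%G ->
    u \in nonF_vertices snil G.
  move=> Gu Gv nil'uv; rewrite inE Gu andbT.
  by apply/negP=> /I_setP[_ /(_ v Gv)].
move=> Gx Gy nil'xy; apply/and4P; split; first exact: vertexI Gx Gy nil'xy.
- by apply: vertexI Gy Gx _; rewrite gen2C.
- apply/eqP=> eqxy; case: nil'xy; rewrite -eqxy.
  suff -> : <<[set x; x]>>%G = <[x]>%G by apply: snil_cycle.
  by apply/val_inj; rewrite /= setUid.
exact/asboolP.
Qed.

Lemma nonF_adj_sym G x y : nonF_adj snil G x y = nonF_adj snil G y x.
Proof. by apply/and4P/and4P; rewrite eq_sym gen2C => -[]. Qed.

(** Allowing z to be a power of y is what makes a product of commuting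
elements of coprime orders inherit the neighbours of both factors. *)
Lemma nonF_adj_cycle i G x y z : x \in G -> y \in G ->
  z \in <[y]> -> (sigma i)^'.-elt z -> z \notin 'C[x.`_(sigma i)] ->
  nonF_adj snil G x y.
Proof.
move=> Gx Gy yz i'z /negP ncz; apply: nonF_adjI => // nilxy; case: ncz.
apply: snil_cent nilxy _ _ (p_elt_constt _ _) i'z; first by rewrite groupX ?gen2l.
by apply: subsetP yz; rewrite cycle_subG gen2r.
Qed.

(** If x is not sigma-central, then some x_i does not commute with some
sigma i'-element, hence not with one of its p-parts. *)
Lemma nonF_vertex_elt G x : x \in nonF_vertices snil G ->
  exists i j a, [/\ i <> j, a \in G, (sigma j).-elt a & a \notin 'C[x.`_(sigma i)]].
Proof.
case/setDP=> Gx /negP nIx; apply: contrapT => no_a; case: nIx.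
apply/I_set_central; split=> // i y Gy i'y.
apply: mem_constt_primes => p piyp; apply: contrapT => /negP ncy.
have [j jp] : exists j, p \in sigma j.
  by apply: class_of_prime; move: piyp; rewrite mem_primes => /andP[].
case: no_a; exists i, j, y.`_p; split=> //; last 1 first.
- by apply: sub_p_elt (p_elt_constt _ _) => q /eqP->.
- by move=> ij; have /negP[] := pnatPpi i'y piyp; rewrite ij.
by rewrite groupX.
Qed.

(** Take x ~ a and y ~ b from [nonF_vertex_elt], with a, b in the classes j, l.
Suppose that x ~ b, y ~ a and a ~ b all fail. If j <> l, then a and b commute
and are powers of ab, so ab is adjacent to x and y. If j = l, then <a, b> is a
sigma j-group with j different from both i and k; b commutes with x_i but a
does not, so the sigma j-element ab does not commute with x_i, and in the same
way it does not commute with y_k. *)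
Lemma nonF_walk G x y :
  x \in nonF_vertices snil G -> y \in nonF_vertices snil G ->
  let e := nonF_adj snil G in
  (exists z, e x z /\ e z y) \/ (exists z w, [/\ e x z, e z w & e w y]).
Proof.
move=> Vx Vy e; have [[Gx _] [Gy _]] := (setDP Vx, setDP Vy).
have [i [j [a [ij Ga ja nca]]]] := nonF_vertex_elt Vx.
have [k [l [b [kl Gb lb ncb]]]] := nonF_vertex_elt Vy.
have i'a := sub_p_elt (class_subC ij) ja; have k'b := sub_p_elt (class_subC kl) lb.
have exa : e x a by apply: nonF_adj_cycle i'a nca; rewrite ?cycle_id.
have eby : e b y.
  by rewrite /e nonF_adj_sym; apply: nonF_adj_cycle k'b ncb; rewrite ?cycle_id.
have [nilxb | ] := EM (snil <<[set x; b]>>%G); last first.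
  by move/(nonF_adjI Gx Gb); left; exists b.
have [nilya | ] := EM (snil <<[set y; a]>>%G); last first.
  by move/(nonF_adjI Gy Ga) => eya; left; exists a; rewrite {2}/e nonF_adj_sym.
have [nilab | ] := EM (snil <<[set a; b]>>%G); last first.
  by move/(nonF_adjI Ga Gb); right; exists a, b.
left; exists (a * b); have Gab : a * b \in G by rewrite groupM.
rewrite {2}/e nonF_adj_sym; have [jl | jl] := EM (j = l).
  rewrite -{l}jl in kl lb k'b.
  have jab : (sigma j).-elt (a * b) by rewrite (snil_elt_mul nilab) ?gen2l ?gen2r.
  split.
    apply: nonF_adj_cycle (cycle_id _) (sub_p_elt (class_subC ij) jab) _ => //.
    rewrite groupMr // (snil_cent nilxb (i := i)) ?p_elt_constt ?groupX ?gen2l ?gen2r //.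
    exact: sub_p_elt (class_subC ij) lb.
  apply: nonF_adj_cycle (cycle_id _) (sub_p_elt (class_subC kl) jab) _ => //.
  rewrite groupMl // (snil_cent nilya (i := k)) ?p_elt_constt ?groupX ?gen2l ?gen2r //.
  exact: sub_p_elt (class_subC kl) ja.
have cab : commute a b.
  apply/esym/cent1P; rewrite (snil_cent nilab (i := j)) ?gen2l ?gen2r //.
  exact: sub_p_elt (class_subC jl) lb.
split.
  apply: nonF_adj_cycle i'a nca => //.
  suff {1}<- : (a * b).`_(sigma j) = a by apply: cycle_constt.
  rewrite consttM // constt_p_elt // (constt1P _) ?mulg1 //.
  exact: sub_p_elt (class_subC jl) lb.
apply: nonF_adj_cycle k'b ncb => //.
suff {1}<- : (a * b).`_(sigma l) = b by apply: cycle_constt.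
rewrite consttM // [b.`__]constt_p_elt // (constt1P _) ?mul1g //.
exact: sub_p_elt (class_subC (nesym jl)) ja.
Qed.

End NonNilpotentGraph.

End SigmaNilpotent.

(** * Walks and diameter *)

Section Walks.

Variables (T : finType) (V : {set T}) (e : rel T).

(** When n >= #|T|, the bound holds because the search for a shortest walk is
cut off at #|T|. *)
Lemma graph_dist_walk n x y : walk e n x y -> graph_dist e x y <= n.
Proof.
move=> exy; rewrite /graph_dist leqNgt; apply/negP=> lt_n.
have lt_nT : n < #|T|.
  by apply: leq_trans lt_n _; rewrite -[leqRHS](size_iota 0) find_size.
by have := before_find 0 lt_n; rewrite nth_iota // exy.
Qed.

Lemma walkI (p : seq T) x : path e x p -> walk e (size p) x (last x p).
Proof. by move=> ep; apply/existsP; exists (in_tuple p); rewrite ep eqxx. Qed.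

Lemma walks_diam n :
  {in V &, forall x y, exists p, [/\ path e x p, last x p = y & size p <= n]} ->
  graph_connected V e /\ graph_diam V e <= n.
Proof.
move=> walkV; split=> [x y Vx Vy | ].
  by have [p [ep <- _]] := walkV x y Vx Vy; apply/connectP; exists p.
apply/bigmax_leqP=> x Vx; apply/bigmax_leqP=> y Vy.
have [p [ep <- le_pn]] := walkV x y Vx Vy.
exact: leq_trans (graph_dist_walk (walkI ep)) le_pn.
Qed.

End Walks.

Theorem theorem3 (I : Type) (sigma : I -> nat_pred)
    (sigmaP : prime_partition sigma) :
  [/\ regular_formation (sigma_nilpotent sigma),
      forall (gT : finGroupType) (G : {group gT}),
        I_set (sigma_nilpotent sigma) G = Z_F (sigma_nilpotent sigma) G
    & forall (gT : finGroupType) (G : {group gT}),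
        graph_connected (nonF_vertices (sigma_nilpotent sigma) G)
                        (nonF_adj (sigma_nilpotent sigma) G) /\
        (graph_diam (nonF_vertices (sigma_nilpotent sigma) G)
                    (nonF_adj (sigma_nilpotent sigma) G) <= 3)%N].
Proof.
split=> [|gT G|gT G]; last apply: walks_diam => x y Vx Vy.
- by split=> [|gT G]; [apply: snil_formation | apply: I_set_Int].
- exact: I_set_Z.
have [[z [exz ezy]] | [z [w [exz ezw ewy]]]] := nonF_walk sigmaP Vx Vy.
  by exists [:: z; y]; split=> //=; rewrite exz ezy.
by exists [:: z; w; y]; split=> //=; rewrite exz ezw ewy.
Qed.
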